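(* Let $n,k,r,q$ be integers such that $r\ge 2$, $q\ge -r+1$ and $n\ge k\ge 2q+2r+2$, and let $C'=(q+r)^{\frac{1}{\lfloor k/(q+r+1)\rfloor}}$. Then $$\mathrm{ex}(n,\mathcal{H}^{(r)}(k,q)) < \frac{2C'}{r!}\cdot n^{r-1+\frac{1}{\lfloor k/(q+r+1)\rfloor}}+\frac{2(q+r)}{r!}\cdot n^{r-1}.$$
   Context: An $r$-graph is an $r$-uniform hypergraph $H$ (finite vertex set $V(H)$, edge set $E(H)$, each edge an $r$-element subset of $V(H)$), simple, i.e. without multiple edges; vertices contained in no edge are allowed. A hypergraph $H_1$ is a subhypergraph of $H_2$ if $V(H_1)\subseteq V(H_2)$ and $E(H_1)\subseteq E(H_2)$ (not necessarily induced). For a family $\mathcal{F}$ of $r$-graphs, an $r$-graph is $\mathcal{F}$-free if it has no subhypergraph isomorphic to a member of $\mathcal{F}$, and $\mathrm{ex}(n,\mathcal{F})$ is the maximum number of edges in an $\mathcal{F}$-free $r$-graph on $n$ vertices. For integers $r\ge 2$, $q\ge -r+1$, $k\ge q+r+1$, $\mathcal{H}^{(r)}(k,q)$ is the family of all $r$-graphs $H$ with $|E(H)|-|V(H)|=q+1$ and $q+r+1\le |E(H)|\le k$. *)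

(* Defs.v *)
From HB Require Import structures.
From mathcomp Require Import all_boot all_order all_algebra.
From mathcomp Require Import boolp reals exp.

Set Implicit Arguments.
Unset Strict Implicit.
Unset Printing Implicit Defensive.

Import Order.TTheory GRing.Theory Num.Theory.

Local Open Scope ring_scope.

(* The pair is (vertex set, edge set); the vertex set is a subset of the
   ambient type T, so that subhypergraphs live over the same T. *)
Definition is_rgraph (r : nat) (T : finType)
    (H : {set T} * {set {set T}}) : bool :=
  [forall e in H.2, (e \subset H.1) && (#|e| == r)].

Definition rgraph (r : nat) (T : finType) : Type :=
  {H : {set T} * {set {set T}} | is_rgraph r H}.

HB.instance Definition _ (r : nat) (T : finType) := SubFinite.on (rgraph r T).

Definition vertices (r : nat) (T : finType) (H : rgraph r T) : {set T} :=
  (val H).1.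

Definition edges (r : nat) (T : finType) (H : rgraph r T) : {set {set T}} :=
  (val H).2.

Definition subhypergraph (r : nat) (T : finType) (H1 H2 : rgraph r T) : Prop :=
  vertices H1 \subset vertices H2 /\ edges H1 \subset edges H2.

(* Every edge is of the form val @: A for a unique set A of vertices. *)
Definition isomorphic (r : nat) (T1 T2 : finType)
    (H1 : rgraph r T1) (H2 : rgraph r T2) : Prop :=
  exists f : {x | x \in vertices H1} -> {y | y \in vertices H2},
    bijective f /\
    forall A : {set {x | x \in vertices H1}},
      (val @: A \in edges H1) = (val @: (f @: A) \in edges H2).

Definition family (r : nat) := forall T : finType, rgraph r T -> Prop.

Definition free (r : nat) (F : family r) (T : finType) (G : rgraph r T) : Prop :=
  ~ exists (S : rgraph r T) (U : finType) (H : rgraph r U),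
      [/\ subhypergraph S G, F U H & isomorphic S H].

(* Up to isomorphism, an r-graph on n vertices has vertex set 'I_n.  The value
   is 0 if there is no F-free r-graph on n vertices, which requires F to have
   an edgeless member. *)
Definition ex (r n : nat) (F : family r) : nat :=
  (\max_(G : rgraph r 'I_n | `[< vertices G = [set: 'I_n] /\ free F G >])
    #|edges G|)%N.

Definition Hfam (r k : nat) (q : int) : family r := fun T H =>
  #|edges H|%:Z - #|vertices H|%:Z = q + 1 /\
  q + r%:Z + 1 <= #|edges H|%:Z <= k%:Z.

(* Main.v *)
Require Import Defs.
From HB Require Import structures.
From mathcomp Require Import all_boot all_order all_algebra.
From mathcomp Require Import boolp reals exp.
From mathcomp Require Import zify ring lra.

Set Implicit Arguments.
Unset Strict Implicit.
Unset Printing Implicit Defensive.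

Import Order.TTheory GRing.Theory Num.Theory.

Local Open Scope ring_scope.

(** Put m = q + r >= 1 and let l >= 2 be the integer quotient of k by m + 1.

The hypergraph problem reduces to a graph problem. The link of an
(r - 2)-set A is the graph of the pairs f disjoint from A such that f :|: A is
an edge. If a vertex set X disjoint from A spans |X| + m - 1 edges of the link,
then X :|: A carries |X| + m - 1 hyperedges on |X| + r - 2 vertices, an excess
of exactly m - r + 1 = q + 1; so if moreover 2 <= |X| <= (m + 1) l - m + 1,
these form a member of the forbidden family ([not_free_of_dense_link]).
Averaging over A, a hypergraph reaching the claimed bound has a link with at
least n (D + m) edges, where D ^ l = m n ([exists_dense_link]): with this D the
bound times r! is exactly 2 n ^ (r - 2) times n (D + m).

It remains to find such an X in a graph with n vertices and at least n (D + m)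
edges ([dense_subgraph_exists]). Pass to a subgraph in which all degrees exceed
D + m, and explore it in breadth-first layers L_0, ..., L_l from a vertex x.
Suppose that no X exists. Let b(w) be the number of neighbours of w in the
previous layer. For v in a layer i <= l - 2, look at the edges around v that do
not belong to a suitably chosen breadth-first tree: those from v to its own or
the previous layer, and those from its children to their other parents. Any m
of them, with the tree paths from their endpoints to x, would form a dense X of
size at most (m + 1) (i + 1); so there are at most m - 1 ([local_excess]), that
is
  deg v - |children v| + \sum_(w child of v) (b(w) - 1) <= m.
Hence \sum_(w child of v) (2 - b(w)) >= D. Summing over v in L_i, each w in
L_(i + 1) is counted b(w) times, and b (2 - b) <= 1; so
|L_(i + 1)| >= D |L_i| ([level_growth]), with no loss however large b(w) is.
Only in the last step, from L_(l - 1) to L_l, is the crude bound b(w) <= m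
used. This gives m n >= m |L_l| > D ^ l, contrary to the choice of D
([layered_card_gt]). *)

(** * Counting *)

Lemma exists_subset_card (T : finType) (A : {set T}) n :
  (n <= #|A|)%N -> exists2 B : {set T}, B \subset A & #|B| = n.
Proof.
case/card_geqP=> s [us <- sA]; exists [set z in s].
  by apply/subsetP=> z; rewrite inE => /sA.
by rewrite cardsE; apply/card_uniqP.
Qed.

Lemma card_rel_set (T : finType) (f : T -> {set T}) :
  #|[set q : T * T | q.2 \in f q.1]| = (\sum_z #|f z|)%N.
Proof.
rewrite -sum1_card (eq_bigr (fun z => \sum_(u in f z) 1)%N) => [|z _].
  by rewrite pair_big_dep; apply: eq_bigl => q; rewrite inE.
by rewrite sum1_card.
Qed.

(** * Graphs and breadth-first layers *)

Section Adjacency.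
Local Open Scope nat_scope.
Variables (T : finType) (F : {set {set T}}).

(** Here and below, a graph is the set [F] of its edges, as two-element sets. *)
Definition adj (u v : T) := (u != v) && ([set u; v] \in F).

Definition induced (X : {set T}) := [set f in F | f \subset X].

Lemma adj_sym u v : adj u v = adj v u.
Proof. by rewrite /adj eq_sym setUC. Qed.

(** The properties of the distance to [x] that matter up to depth [l]; vertices
further away may all be put at depth [l.+1]. *)
Definition layering (x : T) (l : nat) (d : T -> nat) :=
  [/\ forall z, (d z == 0) = (z == x),
      forall u v, adj u v -> d v <= (d u).+1
    & forall z, 0 < d z <= l -> exists2 u, adj z u & d z = (d u).+1].

Lemma layering_exists x l : exists d, layering x l d.
Proof.
pose grow B := B :|: [set z | [exists u in B, adj u z]].
pose ball i := iter i grow [set x].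
have ballS i j : i <= j -> ball i \subset ball j.
  elim: j => [|j IH]; first by rewrite leqn0 => /eqP->.
  rewrite leq_eqVlt => /predU1P[->//|]; rewrite ltnS => /IH ij.
  by apply: subset_trans ij _; rewrite /ball iterS subsetUl.
(* The index of the first ball around x that contains the vertex,
   and l.+1 if none of the first l.+1 balls does. *)
pose d z := find (fun i => z \in ball i) (iota 0 l.+1).
have dP z i : i <= l -> (d z <= i) = (z \in ball i).
  move=> il; apply/idP/idP => [di|zi].
    have hz : has (fun i => z \in ball i) (iota 0 l.+1).
      by rewrite has_find size_iota ltnS (leq_trans di).
    have := nth_find 0 hz; rewrite -/(d z) nth_iota ?add0n => [h|]; last first.
      by rewrite ltnS (leq_trans di).
    exact: (subsetP (ballS _ _ di)).
  rewrite leqNgt; apply/negP => lt_id.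
  by have := before_find 0 lt_id; rewrite nth_iota ?ltnS // add0n zi.
have d_adj u v : adj u v -> d v <= (d u).+1.
  move=> uv; have [lu|ul] := leqP l (d u).
    by apply: leq_trans (find_size _ _) _; rewrite size_iota.
  rewrite dP // /ball iterS !inE; apply/orP; right.
  by apply/exists_inP; exists u; rewrite // -/(ball _) -dP // ltnW.
exists d; split=> // z.
  by rewrite -leqn0 dP //= inE.
case/andP; case Ez: (d z) => [//|i] _ il; have il2 := ltnW il.
have : z \in ball i.+1 by rewrite -dP // Ez.
rewrite /ball iterS -/(ball i) in_setU in_set => /orP[|].
  by rewrite -dP // Ez ltnn.
case/exists_inP=> u; rewrite -dP // => ui uz.
exists u; first by rewrite adj_sym.
by apply/eqP; have := d_adj _ _ uz; rewrite Ez eqn_leq !ltnS ui => ->.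
Qed.

End Adjacency.

Section LayeredGraph.
Local Open Scope nat_scope.
Variables (T : finType) (F : {set {set T}}) (x : T) (l : nat) (d : T -> nat).
Hypothesis lay : layering F x l d.

Definition parents z := [set u | adj F z u & d z == (d u).+1].
Definition children z := [set w | adj F z w & d w == (d z).+1].
Definition level i := [set z | d z == i].

(** The choice of a breadth-first tree rooted at [x]. *)
Definition parent_map (p : T -> T) := forall z, 0 < d z <= l -> p z \in parents z.

(** The tree path from [y] towards the root. The root is left out, so that the
size is at most [d y] and the root is counted once in a union of paths. *)
Definition anc (p : T -> T) y := [set iter (val j) p y | j : 'I_(d y)].

Lemma depth_iter p y j : parent_map p -> d y <= l -> j <= d y ->
  d (iter j p y) = d y - j.
Proof.
move=> pP yl; elim: j => [|j IH] jy; first by rewrite subn0.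
have Ej := IH (ltnW jy).
have := pP (iter j p y); rewrite Ej inE -iterS.
by rewrite subn_gt0 jy (leq_trans (leq_subr _ _) yl) => /(_ isT)/andP[_ /eqP]; lia.
Qed.

Lemma mem_anc_self p y : y \in x |: anc p y.
Proof.
have [d0 _ _] := lay; rewrite !inE -d0; case: posnP => //= y0.
by apply/imsetP; exists (Ordinal y0).
Qed.

Lemma anc_closed p y z : parent_map p -> d y <= l -> z \in x |: anc p y -> z != x ->
  [/\ 0 < d z, d z <= l & p z \in x |: anc p y].
Proof.
move=> pP yl; have [d0 _ _] := lay.
rewrite !inE => /predU1P[->|]; first by rewrite eqxx.
case/imsetP=> -[j /= jy] _ -> _.
have Ej := depth_iter pP yl (ltnW jy).
rewrite Ej; split; [lia | lia |].
rewrite -iterS -d0 (depth_iter pP yl jy).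
case: posnP => //= h; apply/imsetP.
have jy' : j.+1 < d y by lia.
by exists (Ordinal jy').
Qed.

Lemma card_anc p y : #|anc p y| <= d y.
Proof. by rewrite -[leqRHS]card_ord leq_imset_card. Qed.

(** A set containing the root and closed under tree parents spans [#|X| - 1] tree
edges, besides the edges in [Q]. Edges are oriented towards the root, and an edge
inside a layer must start at the fixed vertex [v]: this makes the underlying
two-element sets distinct. *)
Lemma closed_set_edges (p : T -> T) (v : T) (X : {set T}) (Q : {set T * T}) :
  parent_map p -> x \in X ->
  (forall z, z \in X -> z != x -> [/\ 0 < d z, d z <= l & p z \in X]) ->
  (forall q, q \in Q -> [/\ adj F q.1 q.2, q.1 \in X, q.2 \in X, q.2 != p q.1
      & (d q.2 < d q.1) || ((q.1 == v) && (d q.2 == d q.1))]) ->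
  #|X| + #|Q| <= #|induced F X|.+1.
Proof.
move=> pP xX Xcl QP.
pose P := [set (z, p z) | z in X :\ x].
have PP q : q \in P -> [/\ adj F q.1 q.2, q.1 \in X, q.2 \in X, q.2 = p q.1
      & d q.2 < d q.1].
  case/imsetP=> z /setD1P[zx zX] -> /=; have [z0 zl pX] := Xcl z zX zx.
  by have := pP z; rewrite inE z0 zl => /(_ isT)/andP[-> /eqP->].
have cP : #|X| = (#|P|).+1.
  by rewrite (cardsD1 x X) xX card_imset // => a b [].
have dPQ : [disjoint P & Q].
  rewrite -setI_eq0; apply/eqP/setP=> q; rewrite !inE; apply/negbTE/negP.
  by case/andP=> /PP[_ _ _ Eq _] /QP[_ _ _]; rewrite Eq eqxx.
have PQ q : q \in P :|: Q -> [/\ adj F q.1 q.2, q.1 \in X, q.2 \in X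
      & (d q.2 < d q.1) || ((q.1 == v) && (d q.2 == d q.1))].
  by case/setUP=> [/PP[-> -> -> _ ->] | /QP[-> -> -> _ ->]].
pose g (q : T * T) := [set q.1; q.2].
have g_inj : {in P :|: Q &, injective g}.
  move=> [a b] [a' b'] /PQ[/= /andP[ab _] _ _ o] /PQ[/= /andP[ab' _] _ _ o'] /setP E.
  have /esym := E a; have /esym := E b; rewrite !inE !eqxx orbT /=.
  case: (eqVneq b b') => [<- _|_].
    by rewrite (negbTE ab) orbF => /eqP->.
  rewrite orbF => /eqP Eb; rewrite -Eb (negbTE ab) /= => /eqP Ea.
  move: o o'; rewrite -Ea -Eb; case: ltngtP => _; rewrite ?andbF ?andbT //= => /eqP av /eqP bv.
  by move: ab; rewrite av bv eqxx.
rewrite cP addSn ltnS -cardsUI.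
have -> : P :&: Q = set0 by apply/eqP; rewrite setI_eq0.
rewrite cards0 addn0 -(card_in_imset g_inj) subset_leq_card //.
apply/subsetP=> f /imsetP[q /PQ[/andP[_ qF] q1 q2 _] ->].
by rewrite inE qF subUset !sub1set q1 q2.
Qed.

(** * Local sparsity *)

Variables (K m : nat).
Hypothesis sparse : forall X : {set T}, x \in X -> #|X| <= K ->
  #|induced F X|.+1 < #|X| + m.

(** [m] non-tree edges near [v], closed up by the tree paths of their endpoints,
would violate sparsity. The path of [v] costs [d v] vertices besides the root.
Each further edge costs at most [c]: it starts at [v] and costs the path of its
other end, or it starts at a tree child of [v], which costs one more vertex. *)
Lemma extra_lt p v c (Q : {set T * T}) :
  parent_map p -> d v <= l -> 1 + d v + m * c <= K ->
  (forall q, q \in Q -> [/\ adj F q.1 q.2, q.2 != p q.1, d q.2 <= d q.1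
      & (q.1 = v /\ d q.2 <= c) \/
        [/\ p q.1 = v, d q.1 = (d v).+1, d v < l, d q.2 <= d v & d v < c]]) ->
  #|Q| < m.
Proof.
move=> pP vl cK QP; rewrite ltnNge; apply/negP => mQ.
have [Q' Q'Q cQ'] := exists_subset_card mQ.
have {}QP q : q \in Q' -> [/\ adj F q.1 q.2, q.2 != p q.1, d q.2 <= d q.1
      & (q.1 = v /\ d q.2 <= c) \/
        [/\ p q.1 = v, d q.1 = (d v).+1, d v < l, d q.2 <= d v & d v < c]].
  by move/(subsetP Q'Q)/QP.
(* The vertices added by the edge q to the path of v. *)
pose S (q : T * T) := if q.1 == v then anc p q.2 else q.1 |: anc p q.2.
pose X := x |: (anc p v :|: \bigcup_(q in Q') S q).
have vX : x |: anc p v \subset X by rewrite /X setUA subsetUl.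
have SX q : q \in Q' -> x |: S q \subset X.
  move=> qQ; rewrite /X setUS // (subset_trans _ (subsetUr _ _)) //.
  exact: bigcup_sup.
have ancX q : q \in Q' -> x |: anc p q.2 \subset X.
  move=> qQ; apply: subset_trans (SX q qQ).
  by rewrite /S; case: ifP => _ //; rewrite setUS // subsetUr.
have X1 q : q \in Q' -> q.1 \in X.
  move=> qQ; case: (eqVneq q.1 v) => [->|ne].
    by apply: (subsetP vX); apply: mem_anc_self.
  by apply: (subsetP (SX q qQ)); rewrite /S (negbTE ne) !inE eqxx orbT.
have X2 q : q \in Q' -> q.2 \in X.
  by move=> qQ; apply: (subsetP (ancX q qQ)); apply: mem_anc_self.
have X_closed z : z \in X -> z != x -> [/\ 0 < d z, d z <= l & p z \in X].
  move=> zX zx; have {zX}: (z \in anc p v) || (z \in \bigcup_(q in Q') S q).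
    by move: zX; rewrite !inE (negbTE zx).
  case/orP=> [zv|/bigcupP[q qQ]].
    have zv' : z \in x |: anc p v by rewrite inE zv orbT.
    have [-> -> h] := anc_closed pP vl zv' zx; split=> //.
    exact: (subsetP vX).
  have [_ _ q12 qP] := QP q qQ.
  have q2l : d q.2 <= l by case: qP q12 => [[-> _]|[_ _ vl' h _]] *; lia.
  have zanc : z \in anc p q.2 -> [/\ 0 < d z, d z <= l & p z \in X].
    move=> zq; have zq' : z \in x |: anc p q.2 by rewrite inE zq orbT.
    have [-> -> h] := anc_closed pP q2l zq' zx; split=> //.
    exact: (subsetP (ancX q qQ)).
  rewrite {1}/S; case: eqP => // ne; rewrite in_setU1 => /predU1P[->|//].
  case: qP => [[]//|[-> -> -> _ _]]; split=> //.
  by apply: (subsetP vX); apply: mem_anc_self.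
have cX : #|X| <= K.
  apply: leq_trans cK; rewrite -addnA.
  apply: leq_trans (leq_card_setU _ _) _; rewrite cards1 leq_add2l.
  apply: leq_trans (leq_card_setU _ _) _; apply: leq_add; first exact: card_anc.
  apply: (@leq_trans (\sum_(q in Q') #|S q|)).
    elim/big_rec2: _ => [|q n B _ nB]; first by rewrite cards0.
    by apply: leq_trans (leq_card_setU _ _) _; rewrite leq_add2l.
  rewrite -cQ' -sum_nat_const; apply: leq_sum => q qQ.
  have [_ _ _ qP] := QP q qQ; have hc := card_anc p q.2; rewrite /S.
  case: eqP => ne; case: qP => [[? h]|[_ h _ h2 h3]] //.
  - lia.
  - lia.
  - by apply: leq_trans (leq_card_setU _ _) _; rewrite cards1; lia.
have xX : x \in X by rewrite !inE eqxx.
have := sparse xX cX; rewrite ltnNge -cQ' => /negP; apply.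
apply: (@closed_set_edges p v) => // q qQ.
have [-> -> q12 qP] := QP q qQ; rewrite X1 // X2 //; split=> //.
case: qP q12 => [[-> _]|[_ -> _ h _] _]; last by rewrite ltnS h.
by rewrite eqxx leq_eqVlt orbC.
Qed.

Lemma mem_children z w : (w \in children z) = (z \in parents w).
Proof. by rewrite !inE adj_sym. Qed.

(** Around [v], every neighbour in [S] but one, and every parent but one of each
child in [D], gives a non-tree edge. The tree is chosen so that [v] is the tree
parent of all its children; otherwise a child could have its tree path away from
[v], and its extra edge would cost a second path. *)
Lemma local_excess v (S D : {set T}) c :
  d v <= l -> 1 + d v + m * c <= K ->
  (forall u, u \in S -> [/\ adj F v u, d u <= d v & d u <= c]) ->
  (forall w, w \in D -> [/\ w \in children v, d v < l & d v < c]) ->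
  #|S| + \sum_(w in D) (#|parents w| - 1) <= m.
Proof.
move=> vl cK SP DP.
(* The pick is nonempty at depths 1 to l; the default z is only used elsewhere. *)
pose p z := if z \in children v then v else odflt z [pick u in parents z].
have pP : parent_map p.
  move=> z zl; rewrite /p; case: ifP => [|_]; first by rewrite mem_children.
  case: pickP => //= none; have [_ _ /(_ z zl)[u zu du]] := lay.
  by have := none u; rewrite /= inE zu du eqxx.
pose f z := if z == v then S :\ p v else if z \in D then parents z :\ v else set0.
have vD : v \notin D.
  by apply/negP => /DP[]; rewrite inE => /andP[_]; rewrite -[d v]addn0 -addnS eqn_add2l.
have : #|[set q | q.2 \in f q.1]| < m.
  apply: (@extra_lt p v c) => //.
  case=> z u; rewrite inE /= /f; case: eqP => [->|_].
    by rewrite in_setD1 => /andP[-> /SP[-> -> ->]]; split=> //; left.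
  case: ifP => [/DP[zv vl' vc]|]; last by rewrite inE.
  have pz : p z = v by rewrite /p zv.
  move: zv; rewrite !inE pz => /andP[_ /eqP->] /and3P[-> -> /eqP[<-]].
  by split=> //; right; split.
rewrite card_rel_set (bigD1 v) //= {1}/f eqxx => lt_m.
have Scard : #|S| <= #|S :\ p v|.+1 by rewrite (cardsD1 (p v)) -add1n leq_add2r leq_b1.
have Dcard : \sum_(w in D) (#|parents w| - 1) <= \sum_(z | z != v) #|f z|.
  rewrite (bigID (fun z => z \in D) (fun z => z != v)) /=.
  apply: leq_trans (leq_addr _ _).
  rewrite [leqRHS](eq_bigl (fun z => z \in D)) => [|z]; last first.
    by rewrite andb_idl // => zD; apply: contraNneq vD => <-.
  apply: leq_sum => z zD; rewrite /f zD ifN; last by apply: contraNneq vD => <-.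
  by rewrite (cardsD1 v (parents z)); case: (v \in _); rewrite ?addKn ?add0n ?leq_subr.
by lia.
Qed.

(** * Growth of the layers *)

Hypothesis l2 : 2 <= l.
(* The left-hand side is the order of m.+1 paths of length l with common ends. *)
Hypothesis KE : (m.+1 * l.-1).+2 <= K.

(** Paths through [m.+1] parents would form a theta-like subgraph between [w] and
[x]; for [d w = l] its size is exactly the least [K] allowed by [KE]. *)
Lemma card_parents_le w : 0 < d w -> d w <= l -> #|parents w| <= m.
Proof.
move=> w0 wl; have := @local_excess w (parents w) set0 l.-1 wl.
rewrite big_set0 addn0; apply; first by nia.
- by move=> u; rewrite inE => /andP[-> /eqP]; split=> //; lia.
- by move=> u; rewrite inE.
Qed.

Definition neighbors z := [set u | adj F z u].

Lemma card_neighbors v :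
  #|neighbors v| = #|[set u in neighbors v | d u <= d v]| + #|children v|.
Proof.
have [_ d_adj _] := lay.
rewrite -(cardsID [set u | d u <= d v] (neighbors v)); congr (_ + _).
  by apply: eq_card => u; rewrite !inE.
apply: eq_card => u; rewrite !inE -ltnNge andbC.
by case vu: (adj F v u) => //=; have := d_adj _ _ vu; lia.
Qed.

Lemma card_children_ge v : d v < l -> #|neighbors v| <= #|children v| + m.
Proof.
move=> vl; rewrite card_neighbors addnC leq_add2l.
have := @local_excess v [set u in neighbors v | d u <= d v] set0 (d v) (ltnW vl).
rewrite big_set0 addn0; apply; first by nia.
- by move=> u; rewrite !inE => /andP[-> ->].
- by move=> u; rewrite inE.
Qed.

(** The losses of [v], namely its non-forward edges and the sharing of its children
with other vertices, are bounded by [m] jointly and not just separately; this is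
why all layers together lose only one factor [m]. *)
Lemma card_children_excess v : d v < l.-1 ->
  #|neighbors v| + \sum_(w in children v) (#|parents w| - 1) <= #|children v| + m.
Proof.
move=> vl; rewrite card_neighbors addnAC [leqRHS]addnC leq_add2r.
apply: (@local_excess v _ _ (d v).+1); [lia | nia | |].
- by move=> u; rewrite !inE => /andP[-> h]; split=> //; lia.
- by move=> u ->; split=> //; lia.
Qed.

Lemma mem_parents_level z i : d z = i.+1 -> forall u, u \in parents z -> u \in level i.
Proof. by move=> zi u; rewrite !inE zi eqSS eq_sym => /andP[_ ->]. Qed.

Lemma exchange_layers (R : nmodType) i (f : T -> R) :
  (\sum_(v in level i) \sum_(w in children v) f w =
   \sum_(w in level i.+1) \sum_(v in parents w) f w)%R.
Proof.
rewrite (exchange_big_dep (fun w => w \in level i.+1)) /= => [|v w].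
  apply: eq_bigr => w wi; apply: eq_bigl => v.
  rewrite mem_children andb_idl // => /mem_parents_level; apply.
  by move: wi; rewrite inE => /eqP.
by rewrite !inE => /eqP <- /andP[_ ->].
Qed.

Local Open Scope ring_scope.
Variables (R : realFieldType) (D : R).
Hypothesis D0 : 0 < D.
Hypothesis degree_gt : forall v, (d v < l)%N -> D + m%:R < #|neighbors v|%:R.

(** A vertex [w] with [b] parents contributes [2 - b] to each of them, in total
[b * (2 - b) <= 1]; and each vertex receives at least [D] from its children by
[card_children_excess]. *)
Lemma level_growth i : (i.+1 < l)%N -> D * #|level i|%:R <= #|level i.+1|%:R.
Proof.
move=> il.
apply: (@le_trans _ _ (\sum_(v in level i) \sum_(w in children v) (2 - #|parents w|%:R))).
  rewrite mulrC mulr_natl -sumr_const; apply: ler_sum => v; rewrite inE => /eqP vi.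
  have vl : (d v < l.-1)%N by lia.
  have /ltW := degree_gt (leq_trans vl (leq_pred l)).
  have := card_children_excess vl; rewrite -(ler_nat R) !natrD natr_sum => h1 h2.
  have -> : \sum_(w in children v) (2 - #|parents w|%:R) =
      #|children v|%:R - \sum_(w in children v) (#|parents w| - 1)%:R :> R.
    rewrite -sum1_card natr_sum -sumrB; apply: eq_bigr => w wv.
    rewrite natrB; first by ring.
    by apply/card_gt0P; exists v; rewrite -mem_children.
  by lra.
rewrite exchange_layers -sum1_card natr_sum; apply: ler_sum => w _.
by rewrite sumr_const -mulr_natl; have := sqr_ge0 (#|parents w|%:R - 1 : R); nra.
Qed.

Lemma level_lower_bound i : (i < l)%N -> D ^+ i <= #|level i|%:R.
Proof.
elim: i => [_|i IH il].
  have [d0 _ _] := lay; rewrite (@eq_card _ _ (pred1 x)) ?card1 // => z.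
  by rewrite !inE d0.
apply: le_trans (level_growth il); rewrite exprS ler_pM2l //; apply: IH.
exact: ltnW.
Qed.

(** The last layer is compared with the previous one by counting the edges between
them, at most [m] per vertex of the last layer; this is where the factor [m] on
the right comes from. *)
Lemma layered_card_gt : D ^+ l < m%:R * #|T|%:R.
Proof.
have [h hE] : exists h, l = h.+1 by exists l.-1; lia.
have hl : (h < l)%N by rewrite hE.
apply: (@lt_le_trans _ _ (m%:R * #|level l|%:R)); last first.
  by rewrite ler_wpM2l // ler_nat max_card.
have Lh := level_lower_bound hl.
apply: (@le_lt_trans _ _ (D * #|level h|%:R)).
  by rewrite {1}hE exprS ler_pM2l.
apply: (@lt_le_trans _ _ (\sum_(v in level h) \sum_(w in children v) 1)).
  rewrite mulrC mulr_natl -sumr_const.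
  have /card_gt0P[v0 v0h] : (0 < #|level h|)%N.
    by rewrite -(ltr_nat R); apply: lt_le_trans Lh; rewrite exprn_gt0.
  have lt v : v \in level h -> D < \sum_(w in children v) 1.
    rewrite inE => /eqP vh; rewrite sumr_const.
    have vl : (d v < l)%N by rewrite vh.
    have := card_children_ge vl; rewrite -(ler_nat R) natrD.
    by have := degree_gt vl; lra.
  rewrite (bigD1 v0) //= [ltRHS](bigD1 v0) //= ltr_leD ?lt //.
  by apply: ler_sum => v /andP[/lt/ltW].
rewrite exchange_layers -hE mulr_natr -sumr_const; apply: ler_sum => w wl.
move: wl; rewrite inE => /eqP wl.
by rewrite sumr_const ler_nat card_parents_le // wl // hE.
Qed.

End LayeredGraph.

(** * Dense subgraphs of graphs with many edges *)

Lemma card_induced_setD1 (T : finType) (F : {set {set T}}) (W : {set T}) v :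
  (forall f, f \in F -> #|f| = 2%N) ->
  #|induced F W| = (#|induced F (W :\ v)| + #|neighbors (induced F W) v|)%N.
Proof.
move=> F2.
rewrite -(cardsID [set f : {set T} | v \notin f] (induced F W)); congr (_ + _)%N.
  by apply: eq_card => f; rewrite !inE subsetD1 -andbA.
rewrite -(@card_in_imset _ _ (fun u => [set v; u])) => [|u u']; last first.
  rewrite !inE /adj => /andP[vu _] _ /setP /(_ u).
  by rewrite !inE eqxx orbT eq_sym (negbTE vu) => /esym/eqP.
apply: eq_card => f; rewrite in_setD inE negbK; apply/andP/imsetP => [[vf fW]|[u]].
  have : (#|f| == 2)%N by rewrite F2 //; move: fW; rewrite inE => /andP[].
  case/cards2P=> a [b [ab fE]]; subst f.
  case/set2P: vf => ->; [exists b | exists a] => //; rewrite 1?setUC // inE /adj.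
    by rewrite ab fW.
  by rewrite eq_sym ab setUC fW.
by rewrite inE => /andP[_ h] ->; split=> //; rewrite !inE eqxx.
Qed.

(** In a nonempty [W] of least size spanning at least [#|W| * a] edges, deleting a
vertex of degree at most [a] would leave a smaller such set. *)
Lemma min_degree_subgraph (R : realFieldType) (T : finType) (F : {set {set T}}) (a : R) :
  (forall f, f \in F -> #|f| = 2%N) -> 0 < a -> (0 < #|T|)%N ->
  #|T|%:R * a <= #|F|%:R ->
  exists W : {set T}, W != set0 /\
    forall v, v \in W -> a < #|neighbors (induced F W) v|%:R.
Proof.
move=> F2 a0 T0 Fa.
pose P (W : {set T}) := (W != set0) && (#|W|%:R * a <= #|induced F W|%:R).
have PT : P setT.
  rewrite /P -card_gt0 cardsT T0 /= (_ : induced F setT = F) //.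
  by apply/setP=> f; rewrite inE subsetT andbT.
case: (arg_minnP (fun W : {set T} => #|W|) PT) => W /andP[W0 Wa] minW.
exists W; split=> // v vW; rewrite ltNge; apply/negP => deg_le.
have IW := card_induced_setD1 W v F2.
have cW : #|W| = #|W :\ v|.+1 by rewrite (cardsD1 v W) vW.
have le_W : #|W :\ v|%:R * a <= #|induced F (W :\ v)|%:R.
  by move: Wa deg_le; rewrite IW cW natrD -addn1 natrD mulrDl mul1r; lra.
have [W'0|W'0] := eqVneq (W :\ v) set0.
  suff : (#|induced F W| == 0)%N.
    by move/eqP=> E; move: Wa; rewrite cW E W'0 cards0 mul1r leNgt a0.
  rewrite cards_eq0 -subset0; apply/subsetP=> f; rewrite inE => /andP[/F2 f2].
  by move/subset_leq_card; rewrite f2 cW W'0 cards0.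
by have := minW (W :\ v); rewrite /P W'0 le_W cW ltnn => /(_ isT).
Qed.

(** With degrees above [D + m], a graph without such an [X] would have more than
[D ^+ l / m >= #|T|] vertices within distance [l] of any vertex. *)
Lemma dense_subgraph_exists (R : realFieldType) (T : finType) (F : {set {set T}})
    (l m : nat) (D : R) :
  (forall f, f \in F -> #|f| = 2%N) -> (2 <= l)%N -> (0 < #|T|)%N ->
  0 < D -> (m * #|T|)%:R <= D ^+ l -> #|T|%:R * (D + m%:R) <= #|F|%:R ->
  exists X : {set T}, (0 < #|X| <= (m.+1 * l.-1).+2)%N /\
    (#|X| + m <= #|induced F X|.+1)%N.
Proof.
move=> F2 l2 T0 D0 Dl FD; apply: contrapT => none.
have [|W [/set0Pn[x xW] degW]] := min_degree_subgraph F2 _ T0 FD.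
  by rewrite ltr_wpDr.
have [d lay] := layering_exists (induced F W) x l.
have reach z : (d z < l)%N -> z \in W.
  move=> zl; have [d0 _ par] := lay; case: (posnP (d z)) => [/eqP|z0].
    by rewrite d0 => /eqP->.
  have [|u zu _] := par z; first by rewrite z0 ltnW.
  by move: zu; rewrite /adj !inE subUset !sub1set => /and4P[].
suff : D ^+ l < m%:R * #|T|%:R by rewrite -natrM ltNge Dl.
apply: (layered_card_gt lay _ l2 (leqnn _) D0) => [X xX cX|v /reach/degW//].
rewrite ltnNge; apply/negP => dense; apply: none; exists X; split.
  by rewrite cX andbT; apply/card_gt0P; exists x.
apply: leq_trans dense _; rewrite ltnS subset_leq_card //.
by apply/subsetP=> f; rewrite !inE => /andP[/andP[-> _] ->].
Qed.

(** * Links of (r - 2)-sets *)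

Section Link.
Variables (T : finType) (r : nat) (E : {set {set T}}).
Hypotheses (r2 : (2 <= r)%N) (Er : forall e, e \in E -> #|e| = r).

Definition link (A : {set T}) := [set e :\: A | e in E & A \subset e].

Lemma linkP A f :
  reflect [/\ f :|: A \in E & [disjoint f & A]] (f \in link A).
Proof.
apply: (iffP imsetP) => [[e /setIdP[eE Ae] ->]|[fE fA]].
  rewrite setUC setDE setUIr setUCr setIT (setUidPr Ae); split=> //.
  by rewrite -setDE -setI_eq0 setIDAC -setIDA setDv setI0.
exists (f :|: A); first by rewrite inE fE subsetUr.
by rewrite setDUl setDv setU0; apply/esym/setDidPl.
Qed.

Lemma card_mem_link (A f : {set T}) :
  #|A| = (r - 2)%N -> f \in link A -> #|f| = 2%N.
Proof.
move=> cA /linkP[/Er fE fA]; have := cardsUI f A.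
by rewrite fE cA (disjoint_setI0 fA) cards0; lia.
Qed.

Lemma card_link A : #|link A| = #|[set e in E | A \subset e]|.
Proof.
rewrite /link [LHS]card_in_imset => [|e e' /setIdP[_ Ae] /setIdP[_ Ae'] ee'].
  by apply: eq_card => e; rewrite !inE.
by rewrite -(setID e A) -[RHS](setID e' A) ee' (setIidPr Ae) (setIidPr Ae').
Qed.

Lemma sum_card_link :
  (\sum_(A : {set T} | #|A| == r - 2) #|link A| = #|E| * 'C(r, 2))%N.
Proof.
rewrite (eq_bigr (fun A : {set T} => \sum_(e in E | A \subset e) 1)%N) => [|A _].
  rewrite (exchange_big_dep (mem E)) /= => [|A e _ /andP[]//].
  rewrite -sum_nat_const; apply: eq_bigr => e eE.
  have -> : 'C(r, 2) = 'C(#|e|, r - 2) by rewrite (Er eE) bin_sub.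
  rewrite -cards_draws -[RHS]sum1_card.
  by apply: eq_bigl => A; rewrite inE eE andbC.
by rewrite card_link -sum1_card; apply: eq_bigl => e; rewrite inE.
Qed.

(** Each edge contains ['C(r, 2)] sets of size [r - 2], so the links have
[#|E| * 'C(r, 2)] edges in total, while there are at most
[#|T| ^ (r - 2) / (r - 2)`!] links; and ['C(r, 2) * (r - 2)`! = r`! / 2]. *)
Lemma exists_dense_link (R : realFieldType) (B : R) :
  E != set0 -> 2 * #|T|%:R ^+ (r - 2) * B <= #|E|%:R * r`!%:R ->
  exists2 A : {set T}, #|A| = (r - 2)%N & B <= #|link A|%:R.
Proof.
case/set0Pn=> e eE hB; apply: contrapT => none.
have lt_B (A : {set T}) : #|A| == (r - 2)%N -> #|link A|%:R < B.
  by move=> /eqP cA; rewrite ltNge; apply/negP => BA; apply: none; exists A.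
have [A0 _ /eqP cA0] : exists2 A0 : {set T}, A0 \subset e & #|A0| = (r - 2)%N.
  by apply: exists_subset_card; rewrite (Er eE) leq_subr.
have lt_sum : (#|E| * 'C(r, 2))%:R < 'C(#|T|, r - 2)%:R * B.
  rewrite -sum_card_link natr_sum -card_draws mulr_natl -sumr_const.
  rewrite (bigD1 A0) //= [ltRHS](bigD1 A0) ?inE //= ltr_leD ?lt_B //.
  rewrite [leRHS](eq_bigl (fun A : {set T} => (#|A| == r - 2)%N && (A != A0))).
    by apply: ler_sum => A /andP[/lt_B/ltW].
  by move=> A; rewrite inE.
have B0 : 0 <= B by apply: le_trans (ltW (lt_B _ cA0)).
have le_pow : 'C(#|T|, r - 2)%:R * (r - 2)`!%:R <= #|T|%:R ^+ (r - 2) :> R.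
  rewrite -natrM -natrX ler_nat bin_ffact ffact_prod.
  rewrite -[X in (_ <= _ ^ X)%N]card_ord -prod_nat_const.
  by apply: leq_prod => i _; apply: leq_subr.
have fact_r : r`!%:R = 2 * 'C(r, 2)%:R * (r - 2)`!%:R :> R.
  by rewrite -(bin_fact r2) !natrM; ring.
have f0 : 0 < (r - 2)`!%:R :> R by rewrite ltr0n fact_gt0.
move: hB; apply/negP; rewrite -ltNge fact_r.
apply: (@lt_le_trans _ _ (2 * ('C(#|T|, r - 2)%:R * B) * (r - 2)`!%:R)).
  have -> : #|E|%:R * (2 * 'C(r, 2)%:R * (r - 2)`!%:R) =
      2 * (#|E| * 'C(r, 2))%:R * (r - 2)`!%:R :> R by rewrite natrM; ring.
  by rewrite ltr_pM2r // ltr_pM2l.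
have -> : 2 * ('C(#|T|, r - 2)%:R * B) * (r - 2)`!%:R =
  2 * ('C(#|T|, r - 2)%:R * (r - 2)`!%:R) * B by ring.
by rewrite ler_wpM2r // ler_pM2l.
Qed.

End Link.

Lemma isomorphic_refl (r : nat) (T : finType) (H : Defs.rgraph r T) : isomorphic H H.
Proof.
exists id; split; first by exists id.
by move=> A; rewrite imset_id.
Qed.

(** Only edges may be discarded to reach the excess [q + 1] exactly: adding isolated
vertices instead would need vertices outside [X :|: A], and there may be none.
Vertices of [X] in [A] lie on no edge of the link, so removing them keeps the
link edges in [X], and [m > 0] forces at least two vertices to remain. *)
Lemma not_free_of_dense_link (T : finType) (r k m l : nat) (q : int)
    (G : Defs.rgraph r T) (A X : {set T}) :
  (2 <= r)%N -> (0 < m)%N -> q + r%:Z = m%:Z -> (m.+1 * l <= k)%N -> (0 < l)%N ->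
  vertices G = [set: T] -> #|A| = (r - 2)%N ->
  (0 < #|X| <= (m.+1 * l.-1).+2)%N ->
  (#|X| + m <= #|induced (link (edges G) A) X|.+1)%N ->
  ~ Defs.free (@Hfam r k q) G.
Proof.
move=> r2 m0 qm mlk l0 GT cA /andP[X0 Xle] dense; apply.
have Gr e : e \in edges G -> #|e| = r.
  by have /forall_inP Gp := valP G => /Gp/andP[_ /eqP].
pose I := induced (link (edges G) A) X.
pose X' := X :\: A.
have IP f : f \in I -> [/\ f :|: A \in edges G, [disjoint f & A], f \subset X'
    & #|f| = 2%N].
  rewrite inE => /andP[fL fX]; have := card_mem_link r2 Gr cA fL.
  by case/linkP: fL => -> fA ->; rewrite /X' subsetD fX.
have X'X : (#|X'| <= #|X|)%N by rewrite subset_leq_card // subsetDl.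
have X'2 : (2 <= #|X'|)%N.
  have /card_gt0P[f /IP[_ _ /subset_leq_card fX <-]] : (0 < #|I|)%N.
    by rewrite /I; lia.
  exact: fX.
have [|J /subsetP JI cJ] := @exists_subset_card _ I (#|X'| + m - 1).
  by rewrite /I; lia.
pose V' := X' :|: A.
pose E' := [set f :|: A | f in J].
have cE : #|E'| = (#|X'| + m - 1)%N.
  rewrite -cJ; apply: card_in_imset => f g /JI/IP[_ fA _ _] /JI/IP[_ gA _ _] fg.
  have drop (h : {set T}) : [disjoint h & A] -> h = (h :|: A) :\: A.
    by move=> hA; rewrite setDUl setDv setU0; apply/esym/setDidPl.
  by rewrite (drop _ fA) fg -drop.
have cV : #|V'| = (#|X'| + (r - 2))%N.
  rewrite -cA -cardsUI; have -> : X' :&: A = set0.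
    by apply: disjoint_setI0; rewrite disjoint_sym disjoints_subset setCD subsetUr.
  by rewrite cards0 addn0.
have E'E : E' \subset edges G.
  by apply/subsetP=> e /imsetP[f /JI/IP[? _ _ _] ->].
have Sr : is_rgraph r (V', E').
  apply/forall_inP=> e eE'; rewrite (Gr e) ?(subsetP E'E) // eqxx andbT.
  by case/imsetP: eE' => f /JI/IP[_ _ fX _] ->; rewrite setSU.
pose S : Defs.rgraph r T := exist _ (V', E') Sr.
exists S, T, S; split; last exact: isomorphic_refl.
  by split; [rewrite GT subsetT | exact: E'E].
rewrite /Hfam /edges /vertices /= cE cV; split; first by lia.
have lE : (m.+1 * l = m.+1 * l.-1 + m.+1)%N by rewrite -mulnSr prednK.
by apply/andP; split; lia.
Qed.

(** * The bound *)

Theorem theorem7 (R : realType) (n k r : nat) (q : int)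
    (hr : (2 <= r)%N) (hq : - r%:Z + 1 <= q)
    (hk : 2 * q + 2 * r%:Z + 2 <= k%:Z) (hn : (k <= n)%N) :
  let l : R := (k%:Z %/ (q + r%:Z + 1))%Z%:~R in
  let C' : R := (q + r%:Z)%:~R `^ (1 / l) in
  (ex n (@Hfam r k q))%:R <
    2 * C' / r`!%:R * n%:R `^ (r%:R - 1 + 1 / l) +
    2 * (q + r%:Z)%:~R / r`!%:R * n%:R ^+ (r - 1)%N.
Proof.
have [m [m0 qm]] : exists m : nat, (0 < m)%N /\ q + r%:Z = m%:Z.
  by exists (absz (q + r%:Z)); lia.
have -> : (k%:Z %/ (q + r%:Z + 1))%Z = (k %/ m.+1)%N%:Z.
  by rewrite qm -PoszD addn1 divz_nat.
rewrite qm /= -!pmulrn; set l := (k %/ m.+1)%N.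
have l2 : (2 <= l)%N by rewrite /l leq_divRL //; lia.
have mlk : (m.+1 * l <= k)%N by rewrite mulnC leq_divM.
have l0 : l%:R != 0 :> R by rewrite pnatr_eq0; lia.
have n0 : (0 < n)%N by lia.
have nR : 0 < n%:R :> R by rewrite ltr0n.
(* D is the real l-th root of m n, the growth rate that n vertices cannot sustain. *)
pose D : R := m%:R `^ (1 / l%:R) * n%:R `^ (1 / l%:R).
have D0 : 0 < D by rewrite mulr_gt0 // powR_gt0 ?ltr0n.
have Dl : D ^+ l = (m * n)%:R.
  by rewrite exprMn -!powR_mulrn ?powR_ge0 // -!powRrM mul1r mulVf // !powRr1 // natrM.
set bound : R := (X in _ < X).
have boundE : bound * r`!%:R = 2 * n%:R ^+ (r - 2) * (n%:R * (D + m%:R)).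
  have nE : n%:R `^ (r%:R - 1 + 1 / l%:R) =
      n%:R ^+ (r - 2) * n%:R * n%:R `^ (1 / l%:R) :> R.
    have -> : r%:R - 1 = (r - 2).+1%:R :> R.
      by rewrite -addn1 natrD natrB //; ring.
    by rewrite powRD ?(gt_eqF nR) ?implybT // powR_mulrn ?ltW // exprSr.
  rewrite /bound nE /D (_ : (r - 1)%N = (r - 2).+1) ?exprSr; last by lia.
  by field; rewrite pnatr_eq0 -lt0n fact_gt0.
have fr : 0 < r`!%:R :> R by rewrite ltr0n fact_gt0.
have bound0 : 0 < bound.
  by rewrite -(pmulr_lgt0 _ fr) boundE !mulr_gt0 // ?exprn_gt0 // addr_gt0 ?ltr0n.
rewrite /ex; apply: (big_ind (fun a : nat => a%:R < bound)) => [|a b|G /asboolP[GT Gfree]] //.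
  by rewrite /maxn; case: ifP.
rewrite ltNge; apply/negP => le_G.
have Gr e : e \in edges G -> #|e| = r.
  by have /forall_inP Gp := valP G => /Gp/andP[_ /eqP].
have [||A cA dense] := @exists_dense_link _ _ (edges G) hr Gr _ (n%:R * (D + m%:R)).
- apply/eqP => G0; move: le_G; rewrite G0 cards0; lra.
- by rewrite card_ord -boundE ler_pM2r.
have [|||X [cX eX]] := @dense_subgraph_exists _ _ (link (edges G) A) l m D
    (fun f => card_mem_link hr Gr cA) l2 _ D0.
- by rewrite card_ord.
- by rewrite card_ord Dl.
- by rewrite card_ord; exact: dense.
apply: (not_free_of_dense_link hr m0 qm mlk _ GT cA cX eX) => //; lia.
Qed.
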